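(* Fix an integer $m\ge1$ and let $$\rho_r(n)=\sum_{\substack{k\ge0\\ k\equiv r\ (\mathrm{mod}\ m)}}\mathsf S_m(n,k)\quad(0\le r<m),\qquad \sigma(n)=\sum_{k=0}^n\mathsf S_m(n,k).$$ Then: (i) each $\rho_r$ satisfies the $m$-Bell recurrence $a_{n+m}=\sum_{k=0}^n\binom nk m^{\,n-k}a_k$ $(n\ge0)$ with initial conditions $\rho_r(n)=\delta_{n,r}$ for $0\le n<m$; hence $\rho_r=B^{(m,r)}$ is the $r$-th primitive $m$-Bell sequence; (ii) the full row sums satisfy $\sigma=\sum_{r=0}^{m-1}\rho_r=B^{(m)}$, the composite $m$-Bell sequence; (iii) every sequence $(a_n)_{n\ge0}$ satisfying the $m$-Bell recurrence is the unique linear combination $\sum_{r=0}^{m-1}a_rB^{(m,r)}$ of the residue-class row sums determined by its initial values $a_0,\dots,a_{m-1}$.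
   Context: The $m$-Stirling numbers of the second kind $\mathsf S_m(n,k)$ are defined for integers $n,k\ge0$ by $\mathsf S_m(0,k)=\delta_{0,k}$, the convention $\mathsf S_m(n,k)=0$ for $k<0$, and the recurrence $\mathsf S_m(n+1,k)=m\lfloor k/m\rfloor\,\mathsf S_m(n,k)+\mathsf S_m(n,k-1)$. For $0\le r<m$, the primitive $m$-Bell sequence $B^{(m,r)}=(B^{(m,r)}_n)_{n\ge0}$ is the unique solution of $a_{n+m}=\sum_{k=0}^n\binom nk m^{\,n-k}a_k$ $(n\ge0)$ with $B^{(m,r)}_n=\delta_{n,r}$ for $0\le n<m$. The composite $m$-Bell sequence is $B^{(m)}=B^{(m,0)}+\cdots+B^{(m,m-1)}$, i.e. the solution with initial values $(1,\dots,1)$. *)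

(* Defs.v *)
From mathcomp Require Import all_boot all_order all_algebra.
From mathcomp Require Import boolp classical_sets cardinality fsbigop.

Set Implicit Arguments.
Unset Strict Implicit.
Unset Printing Implicit Defensive.

Import GRing.Theory.

Local Open Scope classical_set_scope.
Local Open Scope ring_scope.

(* The index k is a natural number: the convention S_m(n,-1) = 0 is the
   [else] branch. *)
Fixpoint mstirling (m n k : nat) : nat :=
  if n is n'.+1 then
    (m * (k %/ m) * mstirling m n' k
     + (if k is k'.+1 then mstirling m n' k' else 0))%N
  else (k == 0)%N.

Lemma mstirling_small m n k : (n < k)%N -> mstirling m n k = 0%N.
Proof.
elim: n k => [|n IHn] [|k] //= lt_nk.
by rewrite !IHn ?muln0 // ltnW.
Qed.

(* Sum over the infinite set of all k congruent to r mod m; it has finite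
   support, and [rhoE] below identifies it with an ordinary finite sum. *)
Definition rho (m r n : nat) : nat :=
  \sum_(k \in [set k : nat | k = r %[mod m]]) mstirling m n k.

Definition sigma (m n : nat) : nat := (\sum_(0 <= k < n.+1) mstirling m n k)%N.

Definition bell_rec (R : comNzSemiRingType) (m : nat) (a : nat -> R) : Prop :=
  forall n, a (n + m)%N =
    \sum_(0 <= k < n.+1) 'C(n, k)%:R * m%:R ^+ (n - k) * a k.

(* [bell_prefix m a0 n] lists the first n terms of the solution of the m-Bell
   recurrence whose initial values are a0 0, ..., a0 (m - 1). *)
Fixpoint bell_prefix (R : comNzSemiRingType) (m : nat) (a0 : nat -> R)
    (n : nat) : seq R :=
  if n is n'.+1 then
    let s := bell_prefix m a0 n' in
    rcons s (if (n' < m)%N then a0 n' else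
      \sum_(0 <= k < (n' - m).+1)
         'C(n' - m, k)%:R * m%:R ^+ (n' - m - k) * s`_k)
  else [::].

Definition bell_solution (R : comNzSemiRingType) (m : nat) (a0 : nat -> R)
    (n : nat) : R := (bell_prefix m a0 n.+1)`_n.

Definition primitive_bell (m r : nat) : nat -> nat :=
  bell_solution m (fun n => (n == r) : nat).

Definition composite_bell (m n : nat) : nat :=
  (\sum_(r < m) primitive_bell m r n)%N.

Lemma rhoE m r n :
  rho m r n = (\sum_(0 <= k < n.+1 | k == r %[mod m]) mstirling m n k)%N.
Proof.
have -> : rho m r n =
    \sum_(k \in [set` [pred k | k == r %[mod m]]]) mstirling m n k.
  by congr (\sum_(k \in _) _); apply/seteqP; split=> k /eqP.
symmetry; apply: bigfs; first exact: iota_uniq.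
move=> k _; rewrite mem_index_iota -leqNgt => lt_nk.
exact: mstirling_small.
Qed.

Section BellSolution.
Variables (R : comNzSemiRingType) (m : nat).
Implicit Types (a b : nat -> R) (n k : nat).

Lemma size_bell_prefix (a0 : nat -> R) n : size (bell_prefix m a0 n) = n.
Proof. by elim: n => //= n IHn; rewrite size_rcons IHn. Qed.

Lemma nth_bell_prefix (a0 : nat -> R) n k :
  (k < n)%N -> (bell_prefix m a0 n)`_k = bell_solution m a0 k.
Proof.
elim: n => // n IHn; rewrite ltnS leq_eqVlt => /predU1P[->//|lt_kn].
by rewrite /= nth_rcons size_bell_prefix lt_kn IHn.
Qed.

Lemma bell_solution_init (a0 : nat -> R) n : (n < m)%N -> bell_solution m a0 n = a0 n.
Proof.
by move=> lt_nm; rewrite /bell_solution /= nth_rcons size_bell_prefix ltnn eqxx lt_nm.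
Qed.

Lemma bell_solution_rec (a0 : nat -> R) : (0 < m)%N -> bell_rec m (bell_solution m a0).
Proof.
move=> m_gt0 n; rewrite {1}/bell_solution /= nth_rcons size_bell_prefix ltnn eqxx.
rewrite ltnNge leq_addl /= addnK; apply: eq_big_nat => k /andP[_ lt_kn].
by rewrite nth_bell_prefix // (leq_trans lt_kn) // -addn1 leq_add2l.
Qed.

Lemma bell_rec_unique a b : (0 < m)%N -> bell_rec m a -> bell_rec m b ->
  (forall n, (n < m)%N -> a n = b n) -> a =1 b.
Proof.
move=> m_gt0 Ha Hb Hab n; elim/ltn_ind: n => n IHn.
have [/Hab//|le_mn] := ltnP n m.
rewrite -(subnK le_mn) Ha Hb; apply: eq_big_nat => k /andP[_ lt_k].
by rewrite IHn // (leq_trans lt_k) // ltn_subrL m_gt0 (leq_trans m_gt0).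
Qed.

End BellSolution.

Lemma composite_bellE m :
  (0 < m)%N -> composite_bell m =1 bell_solution m (fun=> 1%N).
Proof.
move=> m_gt0; apply: (@bell_rec_unique nat m) => //.
- move=> n; rewrite /composite_bell /primitive_bell.
  under eq_bigr => r _ do rewrite (bell_solution_rec _ m_gt0).
  rewrite [LHS]exchange_big /=; apply: eq_big_nat => k _.
  by rewrite [RHS]big_distrr.
- exact: bell_solution_rec.
move=> n lt_nm; rewrite bell_solution_init // /composite_bell.
rewrite (bigD1 (Ordinal lt_nm)) //= /primitive_bell bell_solution_init // eqxx.
rewrite big1 // => r ne_rn; rewrite bell_solution_init //.
by case: eqP => // e; case/eqP: ne_rn; apply/val_inj.
Qed.

(* Main.v *)
Require Import Defs.
From mathcomp Require Import all_boot all_order all_algebra.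

(** Put $p_k(x) = \prod_{j<k} (x - m\lfloor j/m\rfloor)$.  The recurrence of
    the m-Stirling numbers says exactly that $x^n = \sum_k S_m(n,k)\,p_k(x)$.
    The nodes $m\lfloor j/m\rfloor$ come in blocks of $m$ equal values and
    increase by $m$ from one block to the next, so
    $p_{k+m}(x) = x^m p_k(x-m)$.  Hence the linear functional $L_r$ that sends
    $p_k$ to 1 if $k \equiv r$ modulo $m$, and to 0 otherwise, satisfies
    $L_r(x^m f(x-m)) = L_r(f)$; with $f(x) = (x+m)^n$ this is the m-Bell
    recurrence for $\rho_r(n) = L_r(x^n)$.

    On coefficients, comparing $x^m x^n$ with $x^m ((x-m)+m)^n$ gives
    $S_m(n+m,k+m) = \sum_j \binom nj m^{n-j} S_m(j,k)$ for all $k$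
    ([mstirling_shift]), while $S_m(n+m,k) = 0$ for $k < m$
    ([mstirling_eq0]).  The first identity is proved by induction on $n$: both
    sides obey the same recurrence, the right-hand one by Pascal's rule
    ([binomial_transformS]).  Summing over a residue class modulo $m$, which is
    stable under $k \mapsto k+m$, yields the m-Bell recurrence
    ([rho_bell_rec]).

    The rest is linear algebra: a solution of the m-Bell recurrence is
    determined by its first $m$ values, and the primitive sequences are the
    solutions whose initial values form the standard basis. *)

Import GRing.Theory.

Local Open Scope ring_scope.

Definition binomial_transform {R : comNzSemiRingType} (x : R) (f : nat -> R)
    (n : nat) : R :=
  \sum_(0 <= k < n.+1) 'C(n, k)%:R * x ^+ (n - k) * f k.

(** Umbrally the transform is $(x + f)^n$, and this is
    $(x + f)^{n+1} = x (x + f)^n + (x + f)^n f$. *)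
Lemma binomial_transformS {R : comNzSemiRingType} (x : R) (f : nat -> R) n :
  binomial_transform x f n.+1 =
  x * binomial_transform x f n + binomial_transform x (fun k => f k.+1) n.
Proof.
rewrite /binomial_transform big_nat_recl //.
under eq_big_nat => k _ do rewrite binS natrD subSS !mulrDl.
rewrite big_split /= addrA; congr (_ + _).
(* The top term of the shifted sum vanishes because 'C(n, n.+1) = 0. *)
rewrite big_nat_recr //= ['C(n, n.+1)]bin_small // !mul0r addr0.
rewrite [in RHS]big_nat_recl // mulrDr; congr (_ + _).
  by rewrite !bin0 !subn0 exprS !mul1r mulrA.
rewrite big_distrr; apply: eq_big_nat => k /andP[_ lt_kn] /=.
by rewrite -[(n - k)%N]prednK ?subn_gt0 // -subnS exprS mulrCA !mulrA [x * _]mulrC.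
Qed.

(** All nodes of the first block are zero, so $p_k(x) = x^k$ for $k \le m$. *)
Lemma mstirling_diag m n k : (n <= m)%N -> mstirling m n k = (k == n).
Proof.
elim: n k => [//|n IHn] k lt_nm /=.
have IH := IHn _ (ltnW lt_nm); rewrite IH.
have -> : (m * (k %/ m) * (k == n) = 0)%N.
  by case: eqP => [->|_]; rewrite ?muln0 // divn_small // muln0.
by case: k => [//|k]; rewrite IH.
Qed.

(** All nodes of the first block vanish, so $x^m$ divides $x^n$ for $n \ge m$
    and only the $p_k$ with $k \ge m$ occur in it; for $n \le m$ there is only
    $p_n$. *)
Lemma mstirling_eq0 m n k : (k < m)%N -> (k < n)%N -> mstirling m n k = 0%N.
Proof.
elim: n k => [//|n IHn] k lt_km lt_kn /=; rewrite divn_small // muln0 mul0n add0n.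
by case: k lt_km lt_kn => [//|k] lt_km lt_kn; rewrite IHn // ltnW.
Qed.

(** Coefficient of $p_{k+m}(x) = x^m p_k(x-m)$ in $x^{n+m} = x^m ((x-m)+m)^n$.
    In passing from $n$ to $n+1$ the node of index $k+m$ exceeds the node of
    index $k$ by $m$, and the term $x (x + f)^n$ of [binomial_transformS], at
    $x = m$, makes up for this difference. *)
Lemma mstirling_shift m n k : (0 < m)%N ->
  mstirling m (n + m) (k + m) =
  binomial_transform m%:R (fun j => mstirling m j k) n.
Proof.
move=> m_gt0; elim: n k => [|n IHn] k.
  by rewrite mstirling_diag // /binomial_transform big_nat1 !mul1r
    -[X in _ == X]add0n eqn_add2r.
rewrite binomial_transformS -IHn addSn /=.
(* By linearity in f, the transform of the shifted column obeys the
   recurrence of the Stirling numbers in k. *)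
have -> : binomial_transform m%:R (fun j => (m * (k %/ m) * mstirling m j k
    + (if k is k'.+1 then mstirling m j k' else 0))%N) n
  = (m * (k %/ m) * mstirling m (n + m) (k + m)
    + (if k is k'.+1 then mstirling m (n + m) (k' + m) else 0))%N.
  rewrite IHn /binomial_transform.
  under eq_big_nat => j _ do rewrite [_ * (_ + _)%N]mulrDr.
  rewrite big_split /=; congr (_ + _).
    by rewrite big_distrr; apply: eq_big_nat => j _ /=; rewrite [LHS]mulrCA.
  by case: k => [|k]; [rewrite big1 // => j _; exact: mulr0 | rewrite IHn].
have -> : ((k + m) %/ m = (k %/ m).+1)%N by rewrite divnDr // divnn m_gt0 addn1.
(* For k = 0 the left-hand side is the entry of index m - 1, which is zero. *)
have -> : (if (k + m)%N is k'.+1 then mstirling m (n + m) k' else 0%N)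
  = (if k is k'.+1 then mstirling m (n + m) (k' + m) else 0%N).
  case: k => [|k] //; case: m m_gt0 {IHn} => // m _.
  by rewrite add0n mstirling_eq0 // leq_addl.
by rewrite natn mulnS mulnDl -addnA.
Qed.

(** A common range for all $n$ up to a bound, so that the sums over $k$ can be
    exchanged with the sum over the transform index. *)
Lemma rhoE_widen m r n N : (n < N)%N ->
  rho m r n = (\sum_(0 <= k < N | k == r %[mod m]) mstirling m n k)%N.
Proof.
move=> lt_nN; rewrite rhoE [RHS](big_cat_nat _ (n := n.+1)) //=.
rewrite [X in (_ + X)%N]big_nat_cond [X in (_ + X)%N]big1 ?addn0 //.
by move=> k /andP[/andP[lt_nk _] _]; exact: mstirling_small.
Qed.

(** The terms $k < m$ of $\rho_r(n+m)$ vanish, and the others are reindexed by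
    $k \mapsto k+m$, which keeps the residue class. *)
Lemma rho_bell_rec m r : (0 < m)%N -> bell_rec m (rho m r).
Proof.
move=> m_gt0 n.
rewrite rhoE (big_cat_nat _ (n := m)) //=; last by rewrite ltnW // ltnS leq_addl.
rewrite [X in (X + _)%N]big_nat_cond [X in (X + _)%N]big1 ?add0n; last first.
  by move=> k /andP[/andP[_ lt_km] _]; rewrite mstirling_eq0 // ltn_addl.
rewrite -{1}[m]add0n -addSn big_addn addnK.
under eq_bigl => k do rewrite modnDr.
under eq_bigr => k _ do rewrite mstirling_shift //.
rewrite exchange_big /=; apply: eq_big_nat => j /andP[_ lt_jn].
by rewrite -big_distrr -rhoE_widen.
Qed.

Lemma rho_init m r n : (r < m)%N -> (n < m)%N -> rho m r n = (n == r).
Proof.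
move=> lt_rm lt_nm; rewrite rhoE big_mkcond big_nat_recr //= big_nat_cond big1.
  by rewrite add0n mstirling_diag ?(ltnW lt_nm) // eqxx !modn_small //; case: eqP.
move=> k /andP[/andP[_ lt_kn] _].
by rewrite mstirling_diag ?(ltnW lt_nm) // (ltn_eqF lt_kn) if_same.
Qed.

Lemma rho_primitive_bell m r : (r < m)%N -> rho m r =1 primitive_bell m r.
Proof.
move=> lt_rm; have m_gt0 : (0 < m)%N by exact: leq_ltn_trans lt_rm.
apply: (bell_rec_unique m_gt0); first exact: rho_bell_rec.
  exact: bell_solution_rec.
by move=> n lt_nm; rewrite rho_init // /primitive_bell bell_solution_init.
Qed.

Lemma sigma_sum_rho m n : (0 < m)%N -> sigma m n = (\sum_(r < m) rho m r n)%N.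
Proof.
move=> m_gt0; under eq_bigr => r _ do rewrite rhoE big_mkcond.
rewrite exchange_big /=; apply: eq_bigr => k _.
rewrite (bigD1 (Ordinal (ltn_pmod k m_gt0))) //= modn_mod eqxx.
rewrite big1 ?addn0 // => r ne_rk; case: ifP => // /eqP eq_kr.
by case/eqP: ne_rk; apply: val_inj; rewrite /= eq_kr modn_small.
Qed.

Lemma bell_rec_comb (R : comNzSemiRingType) m (I : finType) (c : I -> R)
    (b : I -> nat -> R) :
  (forall i, bell_rec m (b i)) -> bell_rec m (fun n => \sum_i c i * b i n).
Proof.
move=> Hb n; under eq_bigr => i _ do rewrite Hb big_distrr.
rewrite exchange_big; apply: eq_big_nat => k _ /=.
by rewrite big_distrr; apply: eq_bigr => i _; rewrite mulrCA.
Qed.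

Lemma primitive_bell_natr_rec (R : comNzSemiRingType) m r : (0 < m)%N ->
  bell_rec m (fun n => (primitive_bell m r n)%:R : R).
Proof.
move=> m_gt0 n; rewrite /primitive_bell (bell_solution_rec _ m_gt0) natr_sum.
by apply: eq_big_nat => k _; rewrite !natrM natrX !natn.
Qed.

Lemma primitive_bell_comb_init (R : comNzSemiRingType) m (c : 'I_m -> R)
    (i : 'I_m) :
  \sum_(r < m) c r * (primitive_bell m r i)%:R = c i.
Proof.
rewrite (bigD1 i) //= big1 => [|r ne_ri]; rewrite /primitive_bell.
  by rewrite bell_solution_init // eqxx mulr1 addr0.
by rewrite bell_solution_init // (inj_eq val_inj) eq_sym (negPf ne_ri) mulr0.
Qed.

Theorem corollary7p4 (m : nat) (hm : (1 <= m)%N) :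
  (* (i) *)
  (forall r : nat, (r < m)%N ->
     [/\ bell_rec m (rho m r),
         forall n : nat, (n < m)%N -> rho m r n = (n == r)
       & rho m r =1 primitive_bell m r]) /\
  (* (ii) *)
  ((forall n : nat, sigma m n = (\sum_(r < m) rho m r n)%N) /\
   sigma m =1 composite_bell m) /\
  (* (iii) *)
  (forall (R : comNzSemiRingType) (a : nat -> R), bell_rec m a ->
     (forall n : nat, a n = \sum_(r < m) a r * (primitive_bell m r n)%:R) /\
     (forall c : 'I_m -> R,
        (forall n : nat, a n = \sum_(r < m) c r * (primitive_bell m r n)%:R) ->
        forall r : 'I_m, c r = a r)).
Proof.
split; last split; last move=> R a Ha.
- move=> r lt_rm; split; first exact: rho_bell_rec.
    by move=> n; exact: rho_init.
  exact: rho_primitive_bell.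
- split=> n; rewrite sigma_sum_rho //.
  by apply: eq_bigr => r _; exact: rho_primitive_bell.
split=> [|c Hc r]; last by rewrite Hc primitive_bell_comb_init.
apply: (bell_rec_unique hm Ha).
  apply: (@bell_rec_comb R m 'I_m (fun r => a r)
            (fun r n => (primitive_bell m r n)%:R)) => r.
  exact: primitive_bell_natr_rec.
move=> n lt_nm.
by rewrite (primitive_bell_comb_init _ _ (fun r => a r) (Ordinal lt_nm)).
Qed.
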